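(* Let $\mathfrak{g}$ be a finite-dimensional real Lie algebra and let $\phi\colon\mathfrak{g}\times\mathfrak{g}\to\mathbb{R}$ be a non-degenerate bilinear form with symmetric part $\phi_S$ and skew-symmetric part $\phi_A$. Let $\triangle_\phi\colon\mathfrak{g}\times\mathfrak{g}\to\mathfrak{g}$ be the bilinear product defined by $\phi(x\triangle_\phi y,z)=-\phi(y,[x,z])$ for all $x,y,z\in\mathfrak{g}$. Then $\triangle_\phi$ is a left-symmetric structure on $\mathfrak{g}$ if and only if $$\phi_A([x,y],z)+\phi_A([y,z],x)+\phi_A([z,x],y)=\phi_S(x,[y,z])$$ for all $x,y,z\in\mathfrak{g}$.
   Context: A bilinear form $\phi$ (not assumed symmetric or skew-symmetric) on a finite-dimensional real vector space $V$ is non-degenerate if $V\to V^*$, $x\mapsto\phi(x,\cdot)$, is a linear isomorphism. The symmetric and skew-symmetric parts are $\phi_S(x,y)=\tfrac12(\phi(x,y)+\phi(y,x))$ and $\phi_A(x,y)=\tfrac12(\phi(x,y)-\phi(y,x))$, so $\phi=\phi_S+\phi_A$. A bilinear product $\triangle$ on a Lie algebra $\mathfrak{g}$ is a left-symmetric structure on $\mathfrak{g}$ if for all $x,y,z\in\mathfrak{g}$: $x\triangle(y\triangle z)-(x\triangle y)\triangle z=y\triangle(x\triangle z)-(y\triangle x)\triangle z$ and $[x,y]=x\triangle y-y\triangle x$. *)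

(* Defs.v *)
From HB Require Import structures.
From mathcomp Require Import all_boot all_order all_algebra.
From mathcomp Require Import reals.

Set Implicit Arguments.
Unset Strict Implicit.
Unset Printing Implicit Defensive.

Import GRing.Theory.
Local Open Scope ring_scope.

(* Finite-dimensional Lie algebras: [vectType] carries finite dimension. *)
HB.mixin Record Vector_isLieAlgebra (K : fieldType) (g : Type)
    of Vector K g := {
  lie : {bilinear g -> g -> g};
  lie_alternating : forall x : g, lie x x = 0;
  lie_jacobi : forall x y z : g,
    lie x (lie y z) + lie y (lie z x) + lie z (lie x y) = 0
}.

#[short(type="finLieAlgType")]
HB.structure Definition FinLieAlgebra (K : fieldType) :=
  { g of Vector_isLieAlgebra K g & Vector K g }.

Section BilinearForms.
Variables (R : realType) (V : vectType R).

(* The map x |-> phi(x, .) from V to its dual, the dual being 'Hom(V, R^o). *)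
Definition flat (phi : {biscalar V}) (x : V) : 'Hom(V, R^o) :=
  linfun (phi x : V -> R^o).

(* [flat phi] is always linear (see [flat_is_linear]), so being a linear
   isomorphism means being bijective. *)
Definition nondegenerate_form (phi : {biscalar V}) : Prop :=
  bijective (flat phi).

Definition sym_part (phi : {biscalar V}) (x y : V) : R :=
  2^-1 * (phi x y + phi y x).

Definition skew_part (phi : {biscalar V}) (x y : V) : R :=
  2^-1 * (phi x y - phi y x).

Lemma biscalar_right_linear (phi : {biscalar V}) (x : V) :
  linear (phi x : V -> R^o).
Proof. by move=> a y z; rewrite linearP. Qed.

Lemma flatE (phi : {biscalar V}) (x y : V) : flat phi x y = phi x y.
Proof.
pose lin := GRing.isLinear.Build R V R^o _ _ (biscalar_right_linear phi x).
pose f : {linear V -> R^o} := HB.pack (phi x : V -> R^o) lin.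
exact: (lfunE f).
Qed.

Lemma flat_is_linear (phi : {biscalar V}) : linear (flat phi).
Proof.
move=> a x y; apply/lfunP => z.
by rewrite add_lfunE scale_lfunE !flatE linearPl.
Qed.

End BilinearForms.

Definition left_symmetric_structure (K : fieldType) (g : finLieAlgType K)
    (tri : {bilinear g -> g -> g}) : Prop :=
  (forall x y z : g,
     tri x (tri y z) - tri (tri x y) z = tri y (tri x z) - tri (tri y x) z) /\
  (forall x y : g, lie x y = tri x y - tri y x).

(* The equation phi(x tri y, z) = - phi(y, [x, z]), which determines the
   product tri when phi is non-degenerate. *)
Definition is_form_product (R : realType) (g : finLieAlgType R)
    (phi : {biscalar g}) (tri : {bilinear g -> g -> g}) : Prop :=
  forall x y z : g, phi (tri x y) z = - phi y (lie x z).

Section FormProduct.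
Variables (R : realType) (g : finLieAlgType R) (phi : {biscalar g}).
Hypothesis ndphi : nondegenerate_form phi.

Lemma nondegenerate_form_inj (u v : g) : phi u =1 phi v -> u = v.
Proof.
move=> uv; apply: (bij_inj ndphi); apply/lfunP => z.
by rewrite !flatE uv.
Qed.

Lemma form_product_unique (tri tri' : {bilinear g -> g -> g}) :
  is_form_product phi tri -> is_form_product phi tri' ->
  forall x y, tri x y = tri' x y.
Proof.
by move=> h h' x y; apply: nondegenerate_form_inj => z; rewrite h h'.
Qed.

Lemma form_product_exists :
  exists tri : {bilinear g -> g -> g}, is_form_product phi tri.
Proof.
have [inv _ invK] := ndphi.
pose f x y : g -> R^o := fun z => - phi y (lie x z).
have f_lin x y : linear (f x y).
  by move=> a u v; rewrite /f !linearP /= opprD -mulrN.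
pose t x y : g := inv (linfun (f x y)).
have tE x y z : phi (t x y) z = f x y z.
  pose lin := GRing.isLinear.Build R g R^o _ _ (f_lin x y).
  pose F : {linear g -> R^o} := HB.pack (f x y) lin.
  by rewrite -flatE invK (lfunE F).
have t_bilin : bilinear_for *:%R *:%R t.
  split=> [y a x x'|x a y y']; apply: nondegenerate_form_inj => z;
    rewrite linearPl /= !tE /f.
    by rewrite linearPl linearPr /= opprD -mulrN.
  by rewrite linearPl /= opprD -mulrN.
pose bil := bilinear_isBilinear.Build R g g g _ _ t t_bilin.
pose T : {bilinear g -> g -> g} := HB.pack t bil.
by exists T => x y z; exact: tE.
Qed.

End FormProduct.

(* Main.v *)
Require Import Defs.
From HB Require Import structures.
From mathcomp Require Import all_boot all_order all_algebra.
From mathcomp Require Import reals.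
From mathcomp Require Import lra.

Local Open Scope ring_scope.

(** Left multiplication [tri x] is minus the [phi]-adjoint of [lie x], that is,
    the coadjoint representation carried to the Lie algebra by [phi]. Being a
    representation, it satisfies
    [tri x (tri y z) - tri y (tri x z) = tri (lie x y) z] whatever [phi] is.
    Once [lie x y = tri x y - tri y x], this identity is exactly left symmetry,
    so the torsion-free identity is the only real condition
    ([left_symmetric_form_productP]).

    Pairing the torsion with [z], and writing
    [s x y z = sym_part phi x (lie y z)] and [c x y z] for the cyclic sum of
    [skew_part phi (lie x y) z], torsion-freeness becomes
    [c x y z = s x y z + s y z x - s z x y] ([torsion_pairingE]), whereas the
    condition to reach is [c x y z = s x y z]. Since [c] is invariant under
    cyclic permutation, either equation forces the three rotations of [s] to
    coincide, and then the two equations say the same thing. *)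

Import GRing.Theory.

Lemma lieC (K : fieldType) (g : finLieAlgType K) (x y : g) :
  lie y x = - lie x y.
Proof.
apply/eqP; rewrite -addr_eq0; apply/eqP.
have := lie_alternating (x + y).
by rewrite linearDl /= !linearDr /= !lie_alternating add0r addr0 addrC.
Qed.

Lemma lie_jacobi_commutator (K : fieldType) (g : finLieAlgType K) (x y z : g) :
  lie (lie x y) z = lie x (lie y z) - lie y (lie x z).
Proof.
have := lie_jacobi x y z.
rewrite (lieC _ _ (lie x y) z) (lieC _ _ x z) linearNr /= => /eqP.
by rewrite subr_eq0 => /eqP.
Qed.

Section FormProduct.
Context {R : realType} {g : finLieAlgType R} {phi : {biscalar g}}.

Definition skew_cyclic_sum (x y z : g) : R :=
  skew_part phi (lie x y) z + skew_part phi (lie y z) x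
    + skew_part phi (lie z x) y.

Lemma skew_cyclic_sum_rot (x y z : g) :
  skew_cyclic_sum y z x = skew_cyclic_sum x y z.
Proof. by rewrite /skew_cyclic_sum addrC addrA. Qed.

Context {tri : {bilinear g -> g -> g}}.
Hypothesis hphi : nondegenerate_form phi.
Hypothesis htri : is_form_product phi tri.

(** The coadjoint action is a representation: applying the defining equation
    of [tri] twice turns the commutator of left multiplications into a double
    bracket in the second slot of [phi], where the Jacobi identity applies. *)
Lemma form_product_representation (x y z : g) :
  tri x (tri y z) - tri y (tri x z) = tri (lie x y) z.
Proof using hphi htri.
apply: (nondegenerate_form_inj hphi) => w.
rewrite linearBl /= !htri !opprK lie_jacobi_commutator linearBr /=.
by rewrite opprB.
Qed.

Lemma left_symmetric_form_productP :
  left_symmetric_structure tri <->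
  (forall x y : g, lie x y = tri x y - tri y x).
Proof using hphi htri.
split=> [[]//|torsion_free]; split=> // x y z.
have := form_product_representation x y z.
rewrite torsion_free linearBl /= => /eqP.
by rewrite subr_eq => /eqP ->; rewrite addrC -addrA addKr addrC.
Qed.

(** By the defining equation of [tri] the left-hand side is
    [phi (lie x y) z + phi y (lie x z) - phi x (lie y z)]. Split each value of
    [phi] into its two parts: the skew parts add up to the cyclic sum once their
    arguments are swapped, and the symmetric parts give the correction. *)
Lemma torsion_pairingE (x y z : g) :
  phi (lie x y - (tri x y - tri y x)) z =
  skew_cyclic_sum x y z
    - (sym_part phi x (lie y z) + sym_part phi y (lie z x)
         - sym_part phi z (lie x y)).
Proof using htri.
rewrite !linearBl /= !htri /skew_cyclic_sum /skew_part /sym_part.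
rewrite (lieC _ _ z x) linearNr /=; lra.
Qed.

Lemma torsion_freeP :
  (forall x y : g, lie x y = tri x y - tri y x) <->
  (forall x y z : g,
     skew_cyclic_sum x y z =
     sym_part phi x (lie y z) + sym_part phi y (lie z x)
       - sym_part phi z (lie x y)).
Proof using hphi htri.
split=> [torsion_free x y z | cyc x y].
  have := torsion_pairingE x y z.
  by rewrite -torsion_free subrr linear0l => /esym/eqP; rewrite subr_eq0 => /eqP.
apply/eqP; rewrite -subr_eq0; apply/eqP.
apply: (nondegenerate_form_inj hphi) => z.
by rewrite torsion_pairingE cyc subrr linear0l.
Qed.

End FormProduct.

Theorem theorem3p2 (R : realType) (g : finLieAlgType R) (phi : {biscalar g})
    (hphi : nondegenerate_form phi)
    (tri : {bilinear g -> g -> g})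
    (htri : is_form_product phi tri) :
  left_symmetric_structure tri <->
  (forall x y z : g,
     skew_part phi (lie x y) z + skew_part phi (lie y z) x
       + skew_part phi (lie z x) y
     = sym_part phi x (lie y z)).
Proof.
apply: (iff_trans (left_symmetric_form_productP hphi htri)).
apply: (iff_trans (torsion_freeP hphi htri)).
(* Instances of the hypothesis at the three rotations of a triple form a linear
   system which, as the left-hand sides agree, gives the conclusion. *)
split=> cyc x y z; move: (cyc x y z) (cyc y z x) (cyc z x y);
  rewrite -/(skew_cyclic_sum x y z) -/(skew_cyclic_sum y z x)
    -/(skew_cyclic_sum z x y);
  rewrite -(skew_cyclic_sum_rot z x y) (skew_cyclic_sum_rot x y z); lra.
Qed.
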